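(* Let $(\Delta_K,\Delta_G,\Delta_H)$ be a Zappa–Szép Garside structure for the Zappa–Szép product $K=G\bowtie H$. Then the map $\phi:\overline{\mathcal L}_G\times\overline{\mathcal L}_H\to\overline{\mathcal L}_K$ given by \[\phi\big(g_1|g_2|\cdots|g_m\,,\,h_1|h_2|\cdots|h_n\big)=\mathrm{NF}\big(g_1g_2\cdots g_m\,h_1h_2\cdots h_n\big)\] is a bijection.
   Context: Zappa–Szép product: for a monoid $K$ with submonoids $G,H$, write $K=G\bowtie H$ if for every $k\in K$ there exist unique $g_1,g_2\in G$ and $h_1,h_2\in H$ such that $g_1h_1=k=h_2g_2$. Garside monoids: in a monoid $M$ with identity $\mathbf 1$, write $x\preccurlyeq y$ ($x$ is a prefix of $y$) if $y=xu$ for some $u\in M$, and $y\succcurlyeq x$ ($x$ is a suffix of $y$) if $y=ux$ for some $u\in M$. An atom is an element $a\neq\mathbf 1$ such that $a=uv$ implies $u=\mathbf 1$ or $v=\mathbf 1$. $M$ is atomic if it is generated by its atoms and for each $x\in M$ there is an upper bound on the lengths of decompositions of $x$ as a product of atoms. An element is balanced if its set of prefixes equals its set of suffixes; this common set is denoted $\mathrm{Div}(d)$. A Garside structure is a pair $(M,\Delta)$ where $M$ is a cancellative atomic monoid, the prefix and suffix relations are lattice orders, $\Delta\in M$ is balanced, $M$ is generated by $\mathrm{Div}(\Delta)$, and $\mathrm{Div}(\Delta)$ is finite. $M$ is a Garside monoid if such a $\Delta$ (a Garside element) exists. Zappa–Szép Garside structure: $(\Delta_K,\Delta_G,\Delta_H)$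 is one for $K=G\bowtie H$ if $K$ is a Garside monoid (it then follows that $G$ and $H$ are Garside monoids), $\Delta_K,\Delta_G,\Delta_H$ are Garside elements of $K,G,H$ respectively, and $\Delta_K=\Delta_G\Delta_H$. Normal forms: for $M\in\{K,G,H\}$ let $\mathcal D_M=\mathrm{Div}(\Delta_M)$ and, for $x\in\mathcal D_M$, let $\partial_Mx\in\mathcal D_M$ be the unique element with $x\,\partial_Mx=\Delta_M$. Let $\wedge$ denote the meet for the prefix order. $\overline{\mathcal L}_M$ is the set of all words $x_1.x_2.\cdots.x_n$ ($n\ge 0$, including the empty word) over the alphabet $\mathcal D_M\setminus\{\mathbf 1\}$ such that $\partial_Mx_i\wedge x_{i+1}=\mathbf 1$ for $1\le i<n$ (words in left normal form); $x_1|\cdots|x_n$ denotes such a word. For $x\in M$, $\mathrm{NF}(x)$ is the unique word $x_1|\cdots|x_n\in\overline{\mathcal L}_M$ with $x=x_1\cdots x_n$; in the claim $\mathrm{NF}$ is taken in $K$ with respect to $\Delta_K$. *)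

(* Defs.v *)
From HB Require Import structures.
From mathcomp Require Import all_boot all_order.
From mathcomp Require Import boolp classical_sets functions cardinality.

Set Implicit Arguments.
Unset Strict Implicit.
Unset Printing Implicit Defensive.

Local Open Scope classical_set_scope.
Local Open Scope group_scope.

Section Garside.
Variable M : monoidType.
Implicit Types (x y z d u v a : M) (w : seq M) (A : set M).

Definition prefix_of x y : Prop := exists u, y = x * u.

Definition suffix_of x y : Prop := exists u, y = u * x.

Definition atom a : Prop :=
  a <> 1 /\ forall u v, a = u * v -> u = 1 \/ v = 1.

Definition generated_by A : Prop :=
  forall x, exists2 w, (forall a, a \in w -> A a) & x = \prod_(a <- w) a.

Definition atomic : Prop :=
  generated_by atom /\
  forall x, exists N : nat, forall w, (forall a, a \in w -> atom a) ->
    x = \prod_(a <- w) a -> (size w <= N)%N.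

Definition cancellative : Prop :=
  (forall x y z, x * y = x * z -> y = z) /\
  (forall x y z, y * x = z * x -> y = z).

Definition is_meet (le : M -> M -> Prop) x y z : Prop :=
  [/\ le z x, le z y & forall t, le t x -> le t y -> le t z].

Definition is_join (le : M -> M -> Prop) x y z : Prop :=
  [/\ le x z, le y z & forall t, le x t -> le y t -> le z t].

Record lattice_order (le : M -> M -> Prop) : Prop := LatticeOrder {
  lattice_refl : forall x, le x x;
  lattice_anti : forall x y, le x y -> le y x -> x = y;
  lattice_trans : forall y x z, le x y -> le y z -> le x z;
  lattice_meet : forall x y, exists z, is_meet le x y z;
  lattice_join : forall x y, exists z, is_join le x y z
}.

Definition balanced d : Prop :=
  [set x | prefix_of x d] = [set x | suffix_of x d].

(* Only used for balanced d, where prefixes and suffixes coincide. *)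
Definition Div d : set M := [set x | prefix_of x d].

Record garside_structure d : Prop := GarsideStructure {
  garside_cancel : cancellative;
  garside_atomic : atomic;
  garside_prefix : lattice_order prefix_of;
  garside_suffix : lattice_order suffix_of;
  garside_balanced : balanced d;
  garside_generated : generated_by (Div d);
  garside_finite : finite_set (Div d)
}.

Definition garside_monoid : Prop := exists d, garside_structure d.

(* In a Garside structure, the elements picked by [xget] below exist and are
   unique (for [compl d x], when x is in [Div d]); otherwise [xget] may return
   its junk default. *)

Definition meet x y : M := xget 1 [set z | is_meet prefix_of x y z].

Definition compl d x : M := xget 1 [set y | Div d y /\ x * y = d].

Definition left_normal d : set (seq M) :=
  [set w | (forall x, x \in w -> Div d x /\ x <> 1) /\
           (forall i : nat, (i.+1 < size w)%N ->
              meet (compl d (nth 1 w i)) (nth 1 w i.+1) = 1)].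

Definition NF d x : seq M :=
  xget [::] [set w | left_normal d w /\ x = \prod_(a <- w) a].

End Garside.

Section ZappaSzep.
Variables (K : monoidType) (SG SH : pred K).
Variables (G : subMonoidType SG) (H : subMonoidType SH).

Definition zappa_szep : Prop :=
  forall k : K, exists! p : G * G * H * H,
    let: (g1, g2, h1, h2) := p in
    \val g1 * \val h1 = k /\ k = \val h2 * \val g2.

Definition zappa_szep_garside (dK : K) (dG : G) (dH : H) : Prop :=
  [/\ garside_monoid K,
      garside_structure dK,
      garside_structure dG,
      garside_structure dH &
      dK = \val dG * \val dH].

Definition phi (dK : K) (w : seq G * seq H) : seq K :=
  NF dK ((\prod_(g <- w.1) \val g) * (\prod_(h <- w.2) \val h)).

End ZappaSzep.

Arguments zappa_szep {K SG SH} G H.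
Arguments zappa_szep_garside {K SG SH} G H dK dG dH.
Arguments phi {K SG SH} G H dK w.

(* Main.v *)
(** In a Garside structure (M, d), the word x_1|...|x_n is left normal exactly
    when each x_i is the greatest prefix of x_i ... x_n lying in Div d.  So the
    first letter of a normal word is determined by its product, which gives
    uniqueness of normal forms by cancellation; splitting off the meet with d
    repeatedly gives existence, and terminates by atomicity.  Hence words in
    normal form are in bijection with the elements of the monoid, and the
    theorem reduces to the bijectivity of (g, h) |-> g h from G x H to K. *)

Require Import Defs.
From HB Require Import structures.
From mathcomp Require Import all_boot all_order.
From mathcomp Require Import boolp classical_sets functions cardinality.

Local Open Scope classical_set_scope.

Section NormalForm.
Set Implicit Arguments.
Unset Strict Implicit.
Local Open Scope group_scope.
Variables (M : monoidType) (d : M).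
Hypothesis gsd : garside_structure d.
Implicit Types (x y z t : M) (w : seq M).

Let pre := @prefix_of M.

Lemma prefix_mulr x y : pre x (x * y).
Proof. by exists y. Qed.

Lemma prefix_trans y x z : pre x y -> pre y z -> pre x z.
Proof. exact: lattice_trans (garside_prefix gsd) _ _ _. Qed.

Lemma prefix_mul2l x y z : pre (x * y) (x * z) -> pre y z.
Proof.
have [mulI _] := garside_cancel gsd.
by case=> u; rewrite -mulgA => /mulI ->; exists u.
Qed.

Lemma prefix1_eq1 x : pre x 1 -> x = 1.
Proof.
move=> x1; apply: (lattice_anti (garside_prefix gsd)) => //.
by exists x; rewrite mul1g.
Qed.

Lemma prefix_mul_eq1 x y : pre (x * y) x -> y = 1.
Proof. by rewrite -{2}[x]mulg1 => /prefix_mul2l/prefix1_eq1. Qed.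

Lemma meetP x y : is_meet pre x y (meet x y).
Proof.
exact: xgetPex (lattice_meet (garside_prefix gsd) x y).
Qed.

Lemma meet_eq1P x y :
  (forall z, pre z x -> pre z y -> z = 1) <-> meet x y = 1.
Proof.
have [mx my mmax] := meetP x y; split=> [|m1 z zx zy]; first exact.
by apply: prefix1_eq1; rewrite -m1; apply: mmax.
Qed.

(** If [d = x * y * u], then [y * u] is a suffix of [d], hence a prefix since [d] is balanced, and
    [y] is a prefix of it. *)
Lemma Div_mulr x y : Div d (x * y) -> Div d y.
Proof.
case=> u dE; have : [set z | suffix_of z d] (y * u).
  by exists x; rewrite mulgA.
rewrite -(garside_balanced gsd) => yu_d.
exact: prefix_trans (prefix_mulr y u) yu_d.
Qed.

Lemma mul_compl x : Div d x -> x * compl d x = d.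
Proof.
case=> y dE; rewrite /compl; case: xgetP => [z _ [] //|/(_ y) []].
split=> //; apply: (@Div_mulr x); rewrite -dE; exists 1.
by rewrite mulg1.
Qed.

(* With x t the join of x and z, this is d /\ xy = x (x^-1 d /\ y). *)
Lemma Div_prefix_mul x y z : Div d x -> Div d z -> pre z (x * y) ->
  exists t, [/\ pre z (x * t), Div d (x * t) & pre t y].
Proof.
move=> xd zd zxy.
have [j [[t ->] zj jmin]] := lattice_join (garside_prefix gsd) x z.
exists t; split=> //; first exact: jmin.
by apply: (@prefix_mul2l x); apply: jmin => //; apply: prefix_mulr.
Qed.

(** Recursive form of the indexed definition, suited to induction on words. For empty [w] the
    default head 1 makes the meet condition vacuous. *)
Lemma left_normal_cons x w : left_normal d (x :: w) <->
  [/\ Div d x, x <> 1, left_normal d w & meet (compl d x) (head 1 w) = 1].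
Proof.
split=> [[wd wm]|[xd x1 [wd wm] xw]].
- have [xd x1] := wd x (mem_head _ _).
  split=> //; first split=> [y yw|i iw].
  + by apply: wd; rewrite inE yw orbT.
  + exact: (wm i.+1).
  + case: w wm {wd} => [_|y w wm]; last exact: (wm 0).
    by apply/meet_eq1P => z _ /prefix1_eq1.
- split=> [y|[|i] iw]; last exact: wm.
  + by rewrite inE => /orP[/eqP->|/wd].
  + by rewrite /= nth0.
Qed.

Lemma left_normal_head w : left_normal d w ->
  is_meet pre d (\prod_(a <- w) a) (head 1 w).
Proof.
elim: w => [_|x w IH /left_normal_cons[xd x1 /IH[_ _ wmax] /meet_eq1P xw]].
  rewrite big_nil /=; split=> //; last by exists 1; rewrite mulg1.
  by exists d; rewrite mul1g.
rewrite big_cons /=; split=> // [|z zd zxw]; first exact: prefix_mulr.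
have [t [zxt xtd tw]] := Div_prefix_mul xd zd zxw.
(* [t] is a prefix of [compl d x], because [x * t] divides [d], and of the head of [w], by
   induction; normality makes such a common prefix trivial. *)
suff t1 : t = 1 by rewrite t1 mulg1 in zxt.
apply: xw; first by apply: (@prefix_mul2l x); rewrite mul_compl.
by apply: wmax => //; apply: Div_mulr xtd.
Qed.

Lemma left_normal_inj :
  {in left_normal d &, injective (fun w => \prod_(a <- w) a)}.
Proof.
move=> w w' /set_mem + /set_mem.
elim: w w' => [|x w IH] [|x' w'] // lw lw'; rewrite ?big_nil.
- have /left_normal_cons[_ x'1 _ _] := lw'.
  by rewrite big_cons => e; case: x'1; apply: prefix1_eq1; rewrite e;
    apply: prefix_mulr.
- have /left_normal_cons[_ x1 _ _] := lw.
  by rewrite big_cons => e; case: x1; apply: prefix1_eq1; rewrite -e;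
    apply: prefix_mulr.
(* Both heads are meets of [d] with the same product, so they agree and can be cancelled. *)
move=> e; have [xd xw xmax] := left_normal_head lw.
have [xd' xw' xmax'] := left_normal_head lw'.
have xx' : x = x'.
  apply: (lattice_anti (garside_prefix gsd)).
    by apply: xmax' => //; rewrite -e.
  by apply: xmax => //; rewrite e.
subst x'; have [mulI _] := garside_cancel gsd.
move: e; rewrite !big_cons => /mulI e; congr (_ :: _).
have /left_normal_cons[_ _ nw _] := lw.
have /left_normal_cons[_ _ nw' _] := lw'.
exact: IH.
Qed.

(** Write [x] as a product of divisors of [d]. The first factor is a common prefix of [d] and [x];
    if the meet is trivial, the factors vanish one after another. *)
Lemma meet_neq1 x : x <> 1 -> meet d x <> 1.
Proof.
move=> x1 /meet_eq1P dx; apply: x1.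
have [w] := garside_generated gsd x.
elim: w x dx => [|a w IH] x dx wd xE; first by rewrite xE big_nil.
have ax : x = a * \prod_(b <- w) b by rewrite xE big_cons.
have a1 : a = 1.
  by apply: dx; [apply: wd; rewrite mem_head | rewrite ax; apply: prefix_mulr].
apply: IH => //; first by move=> b bw; apply: wd; rewrite inE bw orbT.
by rewrite ax a1 mul1g.
Qed.

(** Induction on a bound [N] for the number of atoms in decompositions of [x]. Since [m = meet d x]
    is nontrivial, it uses at least one atom, so the cofactor [y] has a smaller bound. *)
Lemma left_normal_exists x : exists2 w, left_normal d w & x = \prod_(a <- w) a.
Proof.
have [gen /(_ x) [N bound]] := garside_atomic gsd.
elim: N x bound => [|N IH] x bound.
  have [w wa xE] := gen x; move: (bound w wa xE); rewrite leqn0 => /nilP w0.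
  by exists [::]; rewrite // xE w0.
have [->|/eqP x1] := eqVneq x 1; first by exists [::]; rewrite ?big_nil.
have [md [y xE] mmax] := meetP d x; set m := meet d x in md xE mmax.
have m1 : m <> 1 := meet_neq1 x1.
have [|w nw yE] := IH y.
  move=> v va yE; have [u ua mE] := gen m.
  have u0 : (0 < size u)%N.
    by case: u mE {ua} => // mE; case: m1; rewrite mE big_nil.
  have := bound (u ++ v); rewrite size_cat big_cat -mE -yE.
  have uva a : a \in u ++ v -> atom a by rewrite mem_cat => /orP[/ua|/va].
  by move=> /(_ uva xE) uvN; rewrite -ltnS; apply: leq_trans uvN;
    rewrite -add1n leq_add2r.
exists (m :: w); last by rewrite big_cons -yE.
(* If [z] is a prefix of both [compl d m] and the head of [w], then [m * z] is a prefix of [d] and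
   of [x], hence of [m], so [z = 1]. *)
apply/left_normal_cons; split=> //; apply/meet_eq1P => z zm zw.
have [_ wy _] := left_normal_head nw.
apply: (@prefix_mul_eq1 m); apply: mmax.
  by rewrite -(mul_compl md); case: zm => u ->; exists u; rewrite mulgA.
have [u yzu] : pre z y by rewrite yE; apply: prefix_trans zw wy.
by exists u; rewrite -mulgA -yzu.
Qed.

Lemma NFP x : left_normal d (NF d x) /\ x = \prod_(a <- NF d x) a.
Proof.
have [w nw xE] := left_normal_exists x.
by rewrite /NF; case: xgetP => // /(_ w) [].
Qed.

Lemma NF_prod w : left_normal d w -> NF d (\prod_(a <- w) a) = w.
Proof.
move=> nw; have [nf e] := NFP (\prod_(a <- w) a).
by apply: left_normal_inj; rewrite ?mem_setE ?inE.
Qed.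

End NormalForm.

Section ZappaSzep.
Set Implicit Arguments.
Unset Strict Implicit.
Local Open Scope group_scope.
Variables (K : monoidType) (SG SH : pred K).
Variables (G : subMonoidType SG) (H : subMonoidType SH).
Hypothesis zs : zappa_szep G H.

Lemma zappa_szep_inj (g g' : G) (h h' : H) :
  \val g * \val h = \val g' * \val h' -> g = g' /\ h = h'.
Proof.
move=> e; have [[[[g1 g2] h1] h2] [[_ e2] uniq]] := zs (\val g * \val h).
(* Uniqueness concerns whole quadruples, so both factorizations are completed by the same [h2] and
   [g2]. *)
have [<- <-] := uniq (g, g2, h, h2) (conj erefl e2).
by have [<- <-] := uniq (g', g2, h', h2) (conj (esym e) e2).
Qed.

Lemma zappa_szep_surj k : exists (g : G) (h : H), \val g * \val h = k.
Proof. by have [[[[g ?] h] ?] [[e _] _]] := zs k; exists g, h. Qed.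

End ZappaSzep.

Lemma val_prod (K : monoidType) (S : pred K) (G : subMonoidType S) (w : seq G) :
  (\prod_(g <- w) \val g = \val (\prod_(g <- w) g))%g.
Proof. by elim: w => [|g w IH]; rewrite ?big_nil ?gmulf1 // !big_cons IH gmulfM. Qed.

Theorem theorem54 (K : monoidType) (SG SH : pred K)
    (G : subMonoidType SG) (H : subMonoidType SH)
    (dK : K) (dG : G) (dH : H) :
  zappa_szep G H ->
  zappa_szep_garside G H dK dG dH ->
  set_bij (left_normal dG `*` left_normal dH) (left_normal dK) (phi G H dK).
Proof.
move=> zs [_ gK gG gH _]; split.
- by move=> w _; exact: (NFP gK _).1.
- move=> [u v] [u' v'] /set_mem[/= nu nv] /set_mem[/= nu' nv'].
  rewrite /phi /= !val_prod => e.
  (* Equal normal forms have equal products in [K]. Unique factorization then separates the [G] and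
     [H] parts, and their normal forms recover the words. *)
  have [_ eu] := NFP gK (\val (\prod_(g <- u) g) * \val (\prod_(h <- v) h))%g.
  move: eu; rewrite e -(NFP gK _).2 => /(zappa_szep_inj zs)[eu ev].
  by rewrite -(NF_prod gG nu) -(NF_prod gH nv) eu ev !NF_prod.
- move=> w nw.
  have [g [h gh]] := zappa_szep_surj zs (\prod_(a <- w) a)%g.
  have [[nu uE] [nv vE]] := (NFP gG g, NFP gH h).
  exists (NF dG g, NF dH h) => //.
  by rewrite /phi /= !val_prod -uE -vE gh NF_prod.
Qed.
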